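(* Let $\gamma\in(1,3)$, let $w_*,w^*,\delta_1,\delta_2,T$ be positive constants, and suppose that (A1) $w_*<w'(t)<w^*$ for all $t>0$ holds, and that $(\rho,u)\in C^1(\Omega_T)$ (solution of the piston problem up to time $T$, with shock $x=s(t)$) satisfies, for all $(x,t)\in\Omega_T$, $$(\mathcal H)\quad\begin{cases}|\rho(x,t)-\rho(s(t),t)|\le\rho_\infty^{\frac{\gamma+1}{2\gamma}},\\ |s'(t)-u(x,t)|\le\big(w'(t)^{\frac{\gamma-2}\gamma}+\delta_1\big)\rho_\infty^{\frac{\gamma-1}\gamma},\\ \max\{|t\partial^+c|,|t\partial^-c|\}\le\delta_2\,\rho_\infty^{\frac{\gamma-1}{2\gamma}}.\end{cases}$$ Then for $(x,t)\in\Omega_T$, as $\rho_\infty\to0+$, $$\begin{cases}\rho(x,t)\sim w'(t)^{\frac2\gamma}\rho_\infty^{\frac1\gamma},\\ c(x,t)=\sqrt\gamma\,\rho(x,t)^{\frac{\gamma-1}2}\sim\sqrt\gamma\,w'(t)^{\frac{\gamma-1}\gamma}\rho_\infty^{\frac{\gamma-1}{2\gamma}},\\ \lambda_+(x,t)-s'(t)\sim\sqrt\gamma\,w'(t)^{\frac{\gamma-1}\gamma}\rho_\infty^{\frac{\gamma-1}{2\gamma}},\\ w'(t)-\lambda_-(x,t)\sim\sqrt\gamma\,w'(t)^{\frac{\gamma-1}\gamma}\rho_\infty^{\frac{\gamma-1}{2\gamma}},\\ 1-k_g\sim\frac6{\sqrt\gamma}\,w'(t)^{-\frac1\gamma}\rho_\infty^{\frac{\gamma-1}{2\gamma}}.\end{cases}$$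 Furthermore, there exist maps $\mathcal E:\big(0,\sqrt\gamma\,w_*^{\frac{\gamma-1}\gamma}\big)\to\mathbb R^+$ and $\mathcal W:\big(0,\frac6{\sqrt\gamma}(w^* )^{-\frac1\gamma}\big)\to\mathbb R^+$ such that for $(x,t)\in\Omega_T$: when $\rho_\infty\in(0,\mathcal E(\sigma))$, $$\begin{cases}\lambda_+(x,t)-s'(t)>\big(\sqrt\gamma\,w_*^{\frac{\gamma-1}\gamma}-\sigma\big)\rho_\infty^{\frac{\gamma-1}{2\gamma}},\\ w'(t)-\lambda_-(x,t)>\big(\sqrt\gamma\,w_*^{\frac{\gamma-1}\gamma}-\sigma\big)\rho_\infty^{\frac{\gamma-1}{2\gamma}},\\ \big(\sqrt\gamma\,(w^* )^{\frac{\gamma-1}\gamma}+\sigma\big)\rho_\infty^{\frac{\gamma-1}{2\gamma}}>c(x,t)>\big(\sqrt\gamma\,w_*^{\frac{\gamma-1}\gamma}-\sigma\big)\rho_\infty^{\frac{\gamma-1}{2\gamma}},\end{cases}$$ and when $\rho_\infty\in(0,\mathcal W(\sigma))$, $$|k_g|\le1-\Big(\frac6{\sqrt\gamma}(w^* )^{-\frac1\gamma}-\sigma\Big)\rho_\infty^{\frac{\gamma-1}{2\gamma}} .$$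
   Context: Piston problem: $\rho_\infty>0$ is a constant, $x=w(t)$ is the piston trajectory, $x=s(t)$ is the leading shock front, $w(0)=s(0)=0$, $s(t)>w(t)$ for $t>0$, and $\Omega_T=\{(x,t):0<t<T,\ w(t)\le x\le s(t)\}$. The density $\rho>0$ and velocity $u$ satisfy $\rho_t+(\rho u)_x=0$, $(\rho u)_t+(\rho u^2+\rho^\gamma)_x=0$ in $\Omega_T$; $u(w(t),t)=w'(t)$; and at $x=s(t)$ (values as limits from $x<s(t)$) the Rankine–Hugoniot and entropy conditions $(\rho-\rho_\infty)s'(t)=\rho u$, $\rho u\,s'(t)=\rho u^2+\rho^\gamma-\rho_\infty^\gamma$, $\rho>\rho_\infty$. Asymptotic statements refer to a family, indexed by (small) $\rho_\infty>0$, of piston trajectories $w$ and corresponding solutions $(\rho,u),s$, each satisfying the hypotheses with the same constants $\gamma,w_*,w^*,\delta_1,\delta_2,T$. For quantities $\mathcal F,\mathcal G$ (positive for small $\rho_\infty$) depending on $\rho_\infty$ and $(x,t)$, $\mathcal F\sim\mathcal G$ means $\lim_{\rho_\infty\to0+}\mathcal F=\lim_{\rho_\infty\to0+}\mathcal G=0$ and $\lim_{\rho_\infty\to0+}\mathcal F/\mathcal G=1$, with limits uniform in $(x,t)$. Notation: $\mathbb R^+=(0,\infty)$; $c=\sqrt\gamma\,\rho^{\frac{\gamma-1}2}$, $\lambda_\pm=u\pm c$, $\partial^\pm=\partial_t+\lambda_\pm\partial_x$. The reflection coefficient $k_g=k_g(t)$ at the shock is $$k_g=\left.\frac{\sqrt\gamma\,(k-1)k^{\frac{\gamma-1}2}-f(k)}{f(k)+\sqrt\gamma\,(k-1)k^{\frac{\gamma-1}2}}\cdot\frac{\frac1{\sqrt\gamma}f'(k)k^{\frac{3-\gamma}2}-1}{\frac1{\sqrt\gamma}f'(k)k^{\frac{3-\gamma}2}+1}\right|_{k=\rho(s(t),t)/\rho_\infty},\qquad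 f(k)=\sqrt{\big(1-\tfrac1k\big)(k^\gamma-1)}\ \ (k>1).$$ *)

(* Defs.v *)
From Stdlib Require Import Reals.
From Coquelicot Require Import Coquelicot.

Open Scope R_scope.

Definition uncurried (f : R -> R -> R) : R * R -> R :=
  fun p => f (fst p) (snd p).

Definition interior2 (D : R * R -> Prop) : R * R -> Prop :=
  fun p => locally p D.

Definition approach (D : R * R -> Prop) (x t : R) : (R * R -> Prop) -> Prop :=
  within (interior2 D) (locally (x, t)).

Definition deriv_x (f : R -> R -> R) : R * R -> R :=
  fun p => Derive (fun y => f y (snd p)) (fst p).

Definition deriv_t (f : R -> R -> R) : R * R -> R :=
  fun p => Derive (fun tau => f (fst p) tau) (snd p).

(* Limits from the interior of the classical partial derivatives.  For f of
   class C^1 on D they are the classical partial derivatives at the interior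
   points of D, and their continuous extensions at the boundary points. *)
Definition partial_x (D : R * R -> Prop) (f : R -> R -> R) (x t : R) : R :=
  lim (filtermap (deriv_x f) (approach D x t)).

Definition partial_t (D : R * R -> Prop) (f : R -> R -> R) (x t : R) : R :=
  lim (filtermap (deriv_t f) (approach D x t)).

(* The interior derivatives are required to have a limit at every point of D,
   not only at the boundary ones: [approach] is not a punctured filter, so at
   an interior point this is continuity of the derivative there. *)
Record C1_on (D : R * R -> Prop) (f : R -> R -> R) : Prop := {
  C1_continuous : continuous_on D (uncurried f);
  C1_derivable : forall x t, interior2 D (x, t) ->
    ex_derive (fun y => f y t) x /\ ex_derive (fun tau => f x tau) t;
  C1_extends : forall x t, D (x, t) ->
    (exists l : R, filterlim (deriv_x f) (approach D x t) (locally l)) /\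
    (exists l : R, filterlim (deriv_t f) (approach D x t) (locally l))
}.

(* All real powers below are [Rpower], with positive base. *)

Definition Omega (T : R) (w s : R -> R) : R * R -> Prop :=
  fun p => 0 < snd p < T /\ w (snd p) <= fst p <= s (snd p).

(* The values of rho and u at x = s(t) are limits from x < s(t) by the
   continuity on Omega contained in [C1_on]. *)
Record piston_solution (gamma rinf T : R) (w s : R -> R) (rho u : R -> R -> R)
    : Prop := {
  ps_rinf : 0 < rinf;
  ps_w0 : w 0 = 0;
  ps_s0 : s 0 = 0;
  ps_w_cont0 : filterlim w (at_right 0) (locally (w 0));
  ps_s_cont0 : filterlim s (at_right 0) (locally (s 0));
  ps_w_derivable : forall t, 0 < t -> ex_derive w t;
  ps_s_derivable : forall t, 0 < t < T -> ex_derive s t;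
  ps_ahead : forall t, 0 < t < T -> w t < s t;
  ps_rho_C1 : C1_on (Omega T w s) rho;
  ps_u_C1 : C1_on (Omega T w s) u;
  ps_rho_pos : forall x t, Omega T w s (x, t) -> 0 < rho x t;
  ps_mass : forall x t, Omega T w s (x, t) ->
    partial_t (Omega T w s) rho x t
    + partial_x (Omega T w s) (fun y tau => rho y tau * u y tau) x t = 0;
  ps_momentum : forall x t, Omega T w s (x, t) ->
    partial_t (Omega T w s) (fun y tau => rho y tau * u y tau) x t
    + partial_x (Omega T w s)
        (fun y tau => rho y tau * u y tau ^ 2 + Rpower (rho y tau) gamma) x t
    = 0;
  ps_piston : forall t, 0 < t < T -> u (w t) t = Derive w t;
  ps_RH_mass : forall t, 0 < t < T ->
    (rho (s t) t - rinf) * Derive s t = rho (s t) t * u (s t) t;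
  ps_RH_momentum : forall t, 0 < t < T ->
    rho (s t) t * u (s t) t * Derive s t
    = rho (s t) t * u (s t) t ^ 2 + Rpower (rho (s t) t) gamma
      - Rpower rinf gamma;
  ps_entropy : forall t, 0 < t < T -> rinf < rho (s t) t
}.

Definition speed_bounds (wlo whi : R) (w : R -> R) : Prop :=
  forall t, 0 < t -> wlo < Derive w t < whi.

Definition sound (gamma : R) (rho : R -> R -> R) (x t : R) : R :=
  sqrt gamma * Rpower (rho x t) ((gamma - 1) / 2).

Definition lambda_plus (gamma : R) (rho u : R -> R -> R) (x t : R) : R :=
  u x t + sound gamma rho x t.

Definition lambda_minus (gamma : R) (rho u : R -> R -> R) (x t : R) : R :=
  u x t - sound gamma rho x t.

Definition dir_deriv (D : R * R -> Prop) (lambda f : R -> R -> R) (x t : R)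
    : R :=
  partial_t D f x t + lambda x t * partial_x D f x t.

Record hypH (gamma delta1 delta2 rinf T : R) (w s : R -> R)
    (rho u : R -> R -> R) : Prop := {
  H_density : forall x t, Omega T w s (x, t) ->
    Rabs (rho x t - rho (s t) t) <= Rpower rinf ((gamma + 1) / (2 * gamma));
  H_velocity : forall x t, Omega T w s (x, t) ->
    Rabs (Derive s t - u x t)
    <= (Rpower (Derive w t) ((gamma - 2) / gamma) + delta1)
       * Rpower rinf ((gamma - 1) / gamma);
  H_sound : forall x t, Omega T w s (x, t) ->
    Rmax
      (Rabs (t * dir_deriv (Omega T w s) (lambda_plus gamma rho u)
                   (sound gamma rho) x t))
      (Rabs (t * dir_deriv (Omega T w s) (lambda_minus gamma rho u)
                   (sound gamma rho) x t))
    <= delta2 * Rpower rinf ((gamma - 1) / (2 * gamma))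
}.

Definition shock_f (gamma k : R) : R :=
  sqrt ((1 - 1 / k) * (Rpower k gamma - 1)).

Definition reflection (gamma k : R) : R :=
  (sqrt gamma * (k - 1) * Rpower k ((gamma - 1) / 2) - shock_f gamma k)
  / (shock_f gamma k + sqrt gamma * (k - 1) * Rpower k ((gamma - 1) / 2))
  * ((1 / sqrt gamma * Derive (shock_f gamma) k * Rpower k ((3 - gamma) / 2)
      - 1)
     / (1 / sqrt gamma * Derive (shock_f gamma) k * Rpower k ((3 - gamma) / 2)
        + 1)).

Definition k_g (gamma rinf : R) (s : R -> R) (rho : R -> R -> R) (t : R) : R :=
  reflection gamma (rho (s t) t / rinf).

(* In a family F, the first argument is rinf and the other two are x, t; the
   domain D of (x,t) may depend on rinf. *)
Definition unif_lim (D : R -> R * R -> Prop) (F : R -> R -> R -> R) (l : R)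
    : Prop :=
  forall eps : posreal,
    at_right 0 (fun r => forall x t, D r (x, t) -> Rabs (F r x t - l) < eps).

Definition asymp_equiv (D : R -> R * R -> Prop) (F G : R -> R -> R -> R)
    : Prop :=
  at_right 0 (fun r => forall x t, D r (x, t) -> 0 < F r x t /\ 0 < G r x t) /\
  unif_lim D F 0 /\
  unif_lim D G 0 /\
  unif_lim D (fun r x t => F r x t / G r x t) 1.

(* Main.v *)
(* At the shock, with y = rho_inf / rho, the Rankine-Hugoniot conditions give
     s'^2 rho_inf (1 - y) = rho^gamma (1 - y^gamma).
   Hypothesis (H) evaluated on the piston makes s' - w' small, so y tends to 0
   and rho^gamma / (w'^2 rho_inf) tends to 1.  The remaining parts of (H) carry
   this from the shock to every point of Omega, and the velocity differences
   are of higher order than the sound speed.  The reflection coefficient is a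
   function of y alone, with 1 - k_g equivalent to 6 sqrt (y / gamma) as y tends
   to 0. *)
Require Import Defs.
From Stdlib Require Import Reals Lra Classical IndefiniteDescription.
From Coquelicot Require Import Coquelicot.

Open Scope R_scope.

(** [E] and [W] must serve every solution with the given constants, whereas the asymptotic claims
    concern one family. Both are read off from limits over all admissible states at once, so no
    threshold on the ambient density can depend on the solution. The shock relation gives rho^gamma
    = s'^2 rho_inf (1 - y) / (1 - y^gamma), and the last quotient is known to tend to 1 only after y
    is known to tend to 0. The circle is broken by a crude bound: for gamma < 3 this quotient is at
    least 1/3, which already forces y^gamma to 0. With e = (gamma - 1) / (2 gamma), the sound speed
    is of order rho_inf^e, the velocity errors in (H) are of order rho_inf^(2e), and the density
    oscillation relative to the density is of order rho_inf^e. Every remainder thus gains a factor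
    rho_inf^e. *)

(** * Calculus of real limits along an arbitrary filter *)

Section FilterLimits.
Context {X : Type} {F : (X -> Prop) -> Prop} {FF : Filter F}.

Lemma filterlim_Rabs_locally (f : X -> R) (l : R) :
  filterlim f F (locally l) <->
  (forall eps : posreal, F (fun x => Rabs (f x - l) < eps)).
Proof. exact (filterlim_locally f l). Qed.

Lemma filterlim_locally_eq (f : X -> R) (a b : R) :
  a = b -> filterlim f F (locally a) -> filterlim f F (locally b).
Proof. now intros ->. Qed.

Lemma filterlim_Rplus (f g : X -> R) (a b : R) :
  filterlim f F (locally a) -> filterlim g F (locally b) ->
  filterlim (fun x => f x + g x) F (locally (a + b)).
Proof.
  intros Hf Hg.
  exact (filterlim_comp_2 _ _ _ Hf Hg (filterlim_plus a b)).
Qed.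

Lemma filterlim_Rmult (f g : X -> R) (a b : R) :
  filterlim f F (locally a) -> filterlim g F (locally b) ->
  filterlim (fun x => f x * g x) F (locally (a * b)).
Proof.
  intros Hf Hg.
  exact (filterlim_comp_2 _ _ _ Hf Hg (filterlim_mult a b)).
Qed.

Lemma filterlim_continuous (h : R -> R) (f : X -> R) (a : R) :
  continuous h a -> filterlim f F (locally a) ->
  filterlim (fun x => h (f x)) F (locally (h a)).
Proof. intros Hh Hf. exact (filterlim_comp _ _ _ _ _ _ _ _ Hf Hh). Qed.

Lemma filterlim_Rminus (f g : X -> R) (a b : R) :
  filterlim f F (locally a) -> filterlim g F (locally b) ->
  filterlim (fun x => f x - g x) F (locally (a - b)).
Proof.
  intros Hf Hg.
  refine (filterlim_Rplus _ _ _ _ Hf (filterlim_continuous Ropp g b _ Hg)).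
  exact (filterlim_opp b).
Qed.

Lemma filterlim_Rdiv (f g : X -> R) (a b : R) :
  b <> 0 -> filterlim f F (locally a) -> filterlim g F (locally b) ->
  filterlim (fun x => f x / g x) F (locally (a / b)).
Proof.
  intros Hb Hf Hg.
  exact (filterlim_Rmult _ _ _ _ Hf
           (filterlim_continuous Rinv g b (continuous_Rinv b Hb) Hg)).
Qed.

Lemma filterlim_0_le (f g : X -> R) :
  F (fun x => Rabs (f x) <= g x) -> filterlim g F (locally 0) ->
  filterlim f F (locally 0).
Proof.
  intros Hfg Hg. apply filterlim_Rabs_locally. intros eps.
  apply filterlim_Rabs_locally with (eps := eps) in Hg.
  generalize (filter_and _ _ Hfg Hg). apply filter_imp.
  intros x [H1 H2]. rewrite Rminus_0_r in H2 |- *.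
  pose proof (Rle_abs (g x)). lra.
Qed.

Lemma filterlim_0_scal (M : R) (f : X -> R) :
  filterlim f F (locally 0) -> filterlim (fun x => M * f x) F (locally 0).
Proof.
  intros Hf. rewrite <- (Rmult_0_r M).
  exact (filterlim_Rmult _ _ _ _ (filterlim_const M) Hf).
Qed.

Lemma filterlim_gt (f : X -> R) (a b : R) :
  a < b -> filterlim f F (locally b) -> F (fun x => a < f x).
Proof.
  intros Hab Hf. apply (Hf (fun y => a < y)). exact (open_gt a b Hab).
Qed.

Lemma filterlim_lt (f : X -> R) (a b : R) :
  b < a -> filterlim f F (locally b) -> F (fun x => f x < a).
Proof.
  intros Hab Hf. apply (Hf (fun y => y < a)). exact (open_lt a b Hab).
Qed.

Lemma filterlim_at_right_intro (f : X -> R) (a : R) :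
  F (fun x => a < f x) -> filterlim f F (locally a) ->
  filterlim f F (at_right a).
Proof.
  intros Hpos Hf P HP. generalize (filter_and _ _ Hpos (Hf _ HP)).
  unfold filtermap. apply filter_imp. intros x [H1 H2]. auto.
Qed.

Lemma filterlim_ratio_bounds (f g : X -> R) (eps : R) :
  0 < eps -> (forall q, 0 < g q) ->
  filterlim (fun q => f q / g q) F (locally 1) ->
  F (fun q => (1 - eps) * g q < f q < (1 + eps) * g q).
Proof.
  intros Heps Hg Hlim.
  assert (1 - eps < 1) as Hl by lra. assert (1 < 1 + eps) as Hu by lra.
  generalize (filter_and _ _ (filterlim_gt _ _ _ Hl Hlim)
                (filterlim_lt _ _ _ Hu Hlim)).
  apply filter_imp. intros q [H1 H2]. specialize (Hg q).
  apply Rlt_div_r in H1; [|easy]. apply Rlt_div_l in H2; easy.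
Qed.

Lemma filterlim_ratio_0 (f g : X -> R) :
  (forall q, 0 < g q) ->
  filterlim (fun q => f q / g q) F (locally 1) ->
  filterlim g F (locally 0) -> filterlim f F (locally 0).
Proof.
  intros Hpos Hlim Hg.
  apply filterlim_ext with (f := fun q => f q / g q * g q).
  { intros q. specialize (Hpos q). field. lra. }
  apply (filterlim_locally_eq _ (1 * 0)); [ring|].
  now apply filterlim_Rmult.
Qed.

End FilterLimits.

(** * Real powers with positive base *)

Lemma Rpower_pos (x a : R) : 0 < Rpower x a.
Proof. apply exp_pos. Qed.

Lemma Rpower_1_l (a : R) : Rpower 1 a = 1.
Proof. unfold Rpower. rewrite ln_1, Rmult_0_r. apply exp_0. Qed.

Lemma Rpower_sub (x a b : R) : Rpower x (a - b) = Rpower x a / Rpower x b.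
Proof.
  unfold Rminus, Rdiv. now rewrite Rpower_plus, Rpower_Ropp.
Qed.

Lemma Rpower_Rinv (x a : R) : 0 < x -> Rpower (/ x) a = / Rpower x a.
Proof.
  intros Hx. rewrite <- Rpower_Ropp. unfold Rpower. rewrite ln_Rinv by easy.
  f_equal. ring.
Qed.

Lemma Rpower_Rdiv (x y a : R) :
  0 < x -> 0 < y -> Rpower (x / y) a = Rpower x a / Rpower y a.
Proof.
  intros Hx Hy. unfold Rdiv.
  rewrite <- Rpower_mult_distr, Rpower_Rinv; auto using Rinv_0_lt_compat.
Qed.

Lemma Rpower_gt_1 (x a : R) : 0 < a -> 1 < x -> 1 < Rpower x a.
Proof.
  intros Ha Hx. rewrite <- (Rpower_1_l a). apply Rlt_Rpower_l; lra.
Qed.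

Lemma Rpower_lt_1 (x a : R) : 0 < a -> 0 < x < 1 -> Rpower x a < 1.
Proof.
  intros Ha Hx. rewrite <- (Rpower_1_l a). apply Rlt_Rpower_l; lra.
Qed.

(** The sign of the exponent may vary: (gamma - 2) / gamma changes sign at gamma = 2. Adding both
    endpoint values gives one bound for the increasing and the decreasing case. *)
Lemma Rpower_le_bounds (a b x e : R) :
  0 < a -> a < x < b -> Rpower x e <= Rpower a e + Rpower b e.
Proof.
  intros Ha Hx. pose proof (Rpower_pos a e). pose proof (Rpower_pos b e).
  destruct (Rle_dec 0 e) as [He|He].
  - assert (Rpower x e <= Rpower b e) by (apply Rle_Rpower_l; lra). lra.
  - assert (Rpower a (- e) <= Rpower x (- e)) by (apply Rle_Rpower_l; lra).
    rewrite !Rpower_Ropp in H1.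
    assert (Rpower x e <= Rpower a e); [|lra].
    apply Rinv_le_contravar in H1; [|apply Rinv_0_lt_compat, Rpower_pos].
    now rewrite !Rinv_inv in H1.
Qed.

Lemma continuous_Rpower_l (x a : R) : 0 < x -> continuous (fun y => Rpower y a) x.
Proof.
  intros Hx. apply (ex_derive_continuous (V := R_NormedModule)).
  unfold Rpower. auto_derive. exact Hx.
Qed.

Lemma filterlim_id_at_right (a : R) :
  filterlim (fun y : R => y) (at_right a) (locally a).
Proof. intros P HP. now apply filter_le_within. Qed.

Lemma filterlim_Rpower_0 (a : R) :
  0 < a -> filterlim (fun y => Rpower y a) (at_right 0) (locally 0).
Proof.
  intros Ha. unfold Rpower.
  apply (filterlim_comp _ _ _ (fun y => a * ln y) exp _ (Rbar_locally m_infty)).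
  - apply (filterlim_comp _ _ _ ln (Rmult a) _ (Rbar_locally m_infty)).
    + exact is_lim_ln_0.
    + pose proof (filterlim_Rbar_mult_l a m_infty) as H.
      replace (Rbar_mult a m_infty) with m_infty in H; [exact H|].
      symmetry. apply is_Rbar_mult_unique, is_Rbar_mult_sym.
      now apply is_Rbar_mult_m_infty_pos.
  - exact is_lim_exp_m.
Qed.

(** * The reflection coefficient for a strong shock *)

Lemma is_derive_shock_f (gamma k : R) :
  0 < gamma -> 1 < k ->
  is_derive (shock_f gamma) k
    ((1 / k ^ 2 * (Rpower k gamma - 1)
      + (1 - 1 / k) * (gamma * (Rpower k gamma / k)))
     / (2 * shock_f gamma k)).
Proof.
  intros Hg Hk.
  pose proof (Rpower_gt_1 k gamma Hg Hk) as Hp.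
  assert (1 / k < 1) by (rewrite Rdiv_1_l, <- Rinv_1; apply Rinv_lt_contravar; lra).
  assert (0 < (1 - 1 / k) * (Rpower k gamma - 1)) as Hpos
      by (apply Rmult_lt_0_compat; lra).
  unfold shock_f, Rpower in *. auto_derive.
  - repeat split; first [lra | exact Hpos].
  - pose proof (sqrt_lt_R0 _ Hpos).
    set (e := exp (gamma * ln k)) in *.
    change ((1 + - (1 * / k)) * (e + - (1))) with ((1 - 1 / k) * (e - 1)).
    field. lra.
Qed.

(* With [y = 1 / k] the two factors of the reflection coefficient are
   [(1 - sqrt y * P) / (1 + sqrt y * P)] and [(1 - sqrt y * Q) / (1 + sqrt y * Q)]
   where [P] tends to [1 / sqrt gamma] and [Q] to [2 / sqrt gamma]. *)
Lemma reflection_inv (gamma y : R) :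
  0 < gamma -> 0 < y < 1 ->
  let g := sqrt ((1 - y) * (1 - Rpower y gamma)) in
  let P := g / (sqrt gamma * (1 - y)) in
  let Q := sqrt gamma * (2 * g) / (y * (1 - Rpower y gamma) + (1 - y) * gamma) in
  (1 - reflection gamma (/ y)) / sqrt y
  = 2 * (P + Q) / ((1 + sqrt y * P) * (1 + sqrt y * Q)).
Proof.
  intros Hg Hy g P Q.
  pose proof (Rpower_lt_1 y gamma Hg Hy) as Hyg.
  pose proof (Rpower_pos y gamma) as Hyg0.
  assert (0 < (1 - y) * (1 - Rpower y gamma)) as Hpos
      by (apply Rmult_lt_0_compat; lra).
  assert (0 < g) as Hgpos by now apply sqrt_lt_R0.
  assert (0 < sqrt gamma) as Hsg by now apply sqrt_lt_R0.
  assert (0 < sqrt y) as Hsy by (apply sqrt_lt_R0; lra).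
  assert (sqrt y * sqrt y = y) as Hyy by (apply sqrt_sqrt; lra).
  assert (1 < / y) as Hk by (rewrite <- Rinv_1; apply Rinv_lt_contravar; lra).
  assert (shock_f gamma (/ y) = g / Rpower y (gamma / 2)) as Hf.
  { unfold shock_f.
    replace ((1 - 1 / / y) * (Rpower (/ y) gamma - 1))
      with ((1 - y) * (1 - Rpower y gamma) / Rpower y gamma).
    2:{ rewrite Rpower_Rinv by lra. field. lra. }
    rewrite sqrt_div_alt by easy. fold g. f_equal.
    replace gamma with (gamma / 2 + gamma / 2) at 1 by field.
    rewrite Rpower_plus. apply sqrt_square.
    apply Rlt_le, Rpower_pos. }
  pose proof (Rpower_pos y (gamma / 2)) as Hz.
  assert (Rpower y ((gamma - 1) / 2) = Rpower y (gamma / 2) / sqrt y) as E1.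
  { rewrite <- (Rpower_sqrt y), <- Rpower_sub by lra. f_equal. field. }
  assert (Rpower y ((3 - gamma) / 2) = y * sqrt y / Rpower y (gamma / 2)) as E2.
  { rewrite <- (Rpower_sqrt y) by lra.
    rewrite <- (Rpower_1 y) at 2 by lra.
    rewrite <- Rpower_plus, <- Rpower_sub. f_equal. field. }
  assert (Rpower y gamma = Rpower y (gamma / 2) * Rpower y (gamma / 2)) as E3.
  { rewrite <- Rpower_plus. f_equal. field. }
  (* At k = 1 / y the numerator in [is_derive_shock_f] is y^(1 - gamma) times [h]. *)
  set (h := y * (1 - Rpower y gamma) + (1 - y) * gamma) in *.
  assert (0 < h) as Hh.
  { unfold h. apply Rplus_lt_0_compat; apply Rmult_lt_0_compat; lra. }
  assert (Derive (shock_f gamma) (/ y) = y / Rpower y (gamma / 2) * (h / (2 * g)))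
    as Hd.
  { rewrite (is_derive_unique _ _ _ (is_derive_shock_f gamma (/ y) Hg Hk)).
    rewrite Hf, Rpower_Rinv by lra. unfold h. rewrite E3. field.
    repeat split; lra. }
  unfold reflection. rewrite Hd, Hf, !Rpower_Rinv, E1, E2 by lra.
  set (z := Rpower y (gamma / 2)) in *.
  assert (0 < 1 - y) as H1y by lra.
  assert (0 < P) as HP by (apply Rdiv_lt_0_compat; [|apply Rmult_lt_0_compat]; lra).
  assert (0 < Q) as HQ by (apply Rdiv_lt_0_compat; [apply Rmult_lt_0_compat|]; lra).
  assert (sqrt gamma * (/ y - 1) * / (z / sqrt y) = g / z / (sqrt y * P)) as EA.
  (* The factor sqrt y * sqrt y / y equals 1; it is inserted because [field] does not know that sqrt
     y squares to y. *)
  { transitivity (sqrt gamma * (1 - y) * (sqrt y * sqrt y / y) / (z * sqrt y)).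
    - field. lra.
    - rewrite Hyy. unfold P. field. lra. }
  assert (1 / sqrt gamma * (y / z * (h / (2 * g))) * / (y * sqrt y / z)
          = / (sqrt y * Q)) as EB.
  { unfold Q. field. lra. }
  (* With a = sqrt y * P and b = sqrt y * Q, what remains is 1 - (1 - a) / (1 + a) * ((1 - b) / (1 +
     b)) = 2 (a + b) / ((1 + a) (1 + b)), divided by sqrt y. *)
  rewrite EA, EB.
  assert (0 < sqrt y * P) by now apply Rmult_lt_0_compat.
  assert (0 < sqrt y * Q) by now apply Rmult_lt_0_compat.
  assert (0 < g * (sqrt y * P)) by now apply Rmult_lt_0_compat.
  field. lra.
Qed.

(** The constant is 6 = 2 (1 + 2): [P] contributes 1 / sqrt gamma, [Q] contributes 2 / sqrt gamma,
    and both factors of the denominator tend to 1. *)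
Lemma filterlim_reflection (gamma : R) :
  0 < gamma ->
  filterlim (fun y => (1 - reflection gamma (/ y)) / sqrt y) (at_right 0)
    (locally (6 / sqrt gamma)).
Proof.
  intros Hg.
  assert (0 < sqrt gamma) as Hsg by now apply sqrt_lt_R0.
  assert (at_right 0 (fun y => 0 < y < 1)) as Hloc.
  { exists (mkposreal 1 Rlt_0_1). intros y Hy Hy0.
    change (Rabs (y - 0) < 1) in Hy. apply Rabs_def2 in Hy. lra. }
  refine (filterlim_ext_loc _ _ (filter_imp _ _ _ Hloc) _).
  {  intros y Hy. symmetry.
    exact (reflection_inv gamma y Hg Hy). }
  cbv zeta.
  pose proof (filterlim_id_at_right 0) as Ly.
  pose proof (filterlim_Rpower_0 gamma Hg) as Lp.
  assert (forall a : R, filterlim (fun _ : R => a) (at_right 0) (locally a)) as Lc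
      by (intros a; apply filterlim_const).
  pose proof (filterlim_Rminus _ _ _ _ (Lc 1) Ly) as L1y.
  pose proof (filterlim_Rminus _ _ _ _ (Lc 1) Lp) as L1p.
  pose proof (filterlim_continuous sqrt _ _ (continuous_sqrt _)
                (filterlim_Rmult _ _ _ _ L1y L1p)) as Lg.
  pose proof (filterlim_continuous sqrt _ _ (continuous_sqrt _) Ly) as Ls.
  rewrite !Rminus_0_r, Rmult_1_l, sqrt_1 in Lg. rewrite sqrt_0 in Ls.
  rewrite Rminus_0_r in L1y, L1p.
  assert (filterlim
            (fun y => sqrt ((1 - y) * (1 - Rpower y gamma))
                      / (sqrt gamma * (1 - y)))
            (at_right 0) (locally (1 / (sqrt gamma * 1)))) as LP.
  { apply filterlim_Rdiv; [lra|exact Lg|]. now apply filterlim_Rmult. }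
  assert (filterlim
            (fun y => sqrt gamma * (2 * sqrt ((1 - y) * (1 - Rpower y gamma)))
                      / (y * (1 - Rpower y gamma) + (1 - y) * gamma))
            (at_right 0) (locally (2 / sqrt gamma))) as LQ.
  { replace (2 / sqrt gamma)
      with (sqrt gamma * (2 * 1) / (0 * 1 + 1 * gamma)).
    2:{ transitivity (2 * (sqrt gamma * sqrt gamma) / (gamma * sqrt gamma)).
        - field. lra.
        - rewrite sqrt_sqrt by lra. field. lra. }
    apply filterlim_Rdiv; [lra| |].
    - apply filterlim_Rmult; [easy|]. now apply filterlim_Rmult.
    - apply filterlim_Rplus; now apply filterlim_Rmult. }
  replace (6 / sqrt gamma)
    with (2 * (1 / (sqrt gamma * 1) + 2 / sqrt gamma)
          / ((1 + 0 * (1 / (sqrt gamma * 1))) * (1 + 0 * (2 / sqrt gamma))))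
    by (field; lra).
  apply filterlim_Rdiv.
  - rewrite !Rmult_0_l, !Rplus_0_r. lra.
  - apply filterlim_Rmult; [easy|]. now apply filterlim_Rplus.
  - apply filterlim_Rmult; (apply filterlim_Rplus; [easy|]);
      now apply filterlim_Rmult.
Qed.

(* The claims only depend on these values at a single point (x,t), so that
   uniformity in (x,t) and in the solution becomes convergence along the filter
   [small] on such tuples. *)
Record flow_state := {
  ambient : R;
  piston_speed : R;
  shock_speed : R;
  density : R;
  velocity : R;
  shock_density : R;
  shock_velocity : R
}.

(** * Admissible states and the filter of small ambient density *)

Section SmallAmbientDensity.
Context (gamma wlo whi delta : R).
Context (Hgamma : 1 < gamma < 3) (Hwlo : 0 < wlo).

(** A state mixes three points of one time slice: (x,t), the shock and the piston.
    [adm_velocity_piston] is the velocity bound of (H) at x = w(t), where u is the piston speed. *)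
Record admissible (q : flow_state) : Prop := {
  adm_ambient : 0 < ambient q;
  adm_entropy : ambient q < shock_density q;
  adm_density : 0 < density q;
  adm_piston : wlo < piston_speed q < whi;
  adm_mass : (shock_density q - ambient q) * shock_speed q
             = shock_density q * shock_velocity q;
  adm_momentum : shock_density q * shock_velocity q * shock_speed q
                 = shock_density q * shock_velocity q ^ 2
                   + Rpower (shock_density q) gamma - Rpower (ambient q) gamma;
  adm_oscillation : Rabs (density q - shock_density q)
                    <= Rpower (ambient q) ((gamma + 1) / (2 * gamma));
  adm_velocity : Rabs (shock_speed q - velocity q)
                 <= (Rpower (piston_speed q) ((gamma - 2) / gamma) + delta)
                    * Rpower (ambient q) ((gamma - 1) / gamma);
  adm_velocity_piston : Rabs (shock_speed q - piston_speed q)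
                 <= (Rpower (piston_speed q) ((gamma - 2) / gamma) + delta)
                    * Rpower (ambient q) ((gamma - 1) / gamma)
}.

Definition small (P : flow_state -> Prop) : Prop :=
  exists r0, 0 < r0 /\ forall q, admissible q -> ambient q < r0 -> P q.

(** Only [Filter] is established: properness would amount to the existence of admissible states of
    arbitrarily small ambient density. *)
#[local] Instance small_filter : Filter small.
Proof.
  split.
  - exists 1. split; [lra|easy].
  - intros P Q [a [Ha HP]] [b [Hb HQ]]. exists (Rmin a b). split.
    + now apply Rmin_pos.
    + intros q Hq Hlt. pose proof (Rmin_l a b). pose proof (Rmin_r a b).
      split; [apply HP|apply HQ]; auto; lra.
  - intros P Q HPQ [a [Ha HP]]. exists a. split; auto.
Qed.

Lemma small_admissible (P : flow_state -> Prop) :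
  (forall q, admissible q -> P q) -> small P.
Proof. intros HP. exists 1. split; [lra|auto]. Qed.

Lemma filterlim_ambient : filterlim ambient small (at_right 0).
Proof.
  intros P [eps HP]. exists eps. split; [apply cond_pos|].
  intros q Hq Hlt. pose proof (adm_ambient q Hq). apply HP; [|easy].
  change (Rabs (ambient q - 0) < eps). rewrite Rabs_pos_eq; lra.
Qed.

Lemma filterlim_ambient_Rpower (a : R) :
  0 < a -> filterlim (fun q => Rpower (ambient q) a) small (locally 0).
Proof.
  intros Ha.
  exact (filterlim_comp _ _ _ _ _ _ _ _ filterlim_ambient
           (filterlim_Rpower_0 a Ha)).
Qed.

Lemma adm_piston_pos (q : flow_state) : admissible q -> 0 < piston_speed q.
Proof. intros Hq. pose proof (adm_piston q Hq). lra. Qed.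

(** By (A1) the piston speed stays between two positive constants, so each of its powers is bounded
    uniformly in t and in the solution. *)
Lemma filterlim_piston_scal (e : R) (f : flow_state -> R) :
  filterlim f small (locally 0) ->
  filterlim (fun q => Rpower (piston_speed q) e * f q) small (locally 0).
Proof.
  intros Hf.
  apply filterlim_0_le with
    (g := fun q => (Rpower wlo e + Rpower whi e) * Rabs (f q)).
  - apply small_admissible. intros q Hq.
    rewrite Rabs_mult, (Rabs_pos_eq (Rpower _ _)) by apply Rlt_le, Rpower_pos.
    apply Rmult_le_compat_r; [apply Rabs_pos|].
    apply Rpower_le_bounds; [easy|now apply adm_piston].
  - apply filterlim_0_scal. rewrite <- Rabs_R0.
    apply filterlim_continuous; [apply continuous_Rabs|exact Hf].
Qed.

Definition velocity_error (q : flow_state) : R :=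
  (Rpower (piston_speed q) ((gamma - 2) / gamma) + delta)
  * Rpower (ambient q) ((gamma - 1) / gamma).

Definition density_scale (q : flow_state) : R :=
  Rpower (piston_speed q) (2 / gamma) * Rpower (ambient q) (1 / gamma).

Definition sound_scale (q : flow_state) : R :=
  sqrt gamma * Rpower (piston_speed q) ((gamma - 1) / gamma)
  * Rpower (ambient q) ((gamma - 1) / (2 * gamma)).

Definition reflection_scale (q : flow_state) : R :=
  6 / sqrt gamma * Rpower (piston_speed q) (- (1 / gamma))
  * Rpower (ambient q) ((gamma - 1) / (2 * gamma)).

Definition sound_speed (q : flow_state) : R :=
  sqrt gamma * Rpower (density q) ((gamma - 1) / 2).

Definition shock_reflection (q : flow_state) : R :=
  reflection gamma (shock_density q / ambient q).

Lemma sqrt_gamma_pos : 0 < sqrt gamma.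
Proof. apply sqrt_lt_R0. lra. Qed.

Lemma density_scale_pos (q : flow_state) : 0 < density_scale q.
Proof. apply Rmult_lt_0_compat; apply Rpower_pos. Qed.

Lemma sound_scale_pos (q : flow_state) : 0 < sound_scale q.
Proof.
  repeat apply Rmult_lt_0_compat; auto using Rpower_pos, sqrt_gamma_pos.
Qed.

Lemma reflection_scale_pos (q : flow_state) : 0 < reflection_scale q.
Proof.
  pose proof sqrt_gamma_pos.
  repeat apply Rmult_lt_0_compat; auto using Rpower_pos, Rinv_0_lt_compat; lra.
Qed.

Lemma exponent_pos : 0 < (gamma - 1) / (2 * gamma).
Proof. apply Rdiv_lt_0_compat; lra. Qed.

Lemma filterlim_density_scale : filterlim density_scale small (locally 0).
Proof.
  apply filterlim_piston_scal, filterlim_ambient_Rpower.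
  apply Rdiv_lt_0_compat; lra.
Qed.

Lemma filterlim_scale (c e : R) :
  filterlim (fun q => c * Rpower (piston_speed q) e
                      * Rpower (ambient q) ((gamma - 1) / (2 * gamma)))
    small (locally 0).
Proof.
  apply filterlim_ext with
    (f := fun q => c * (Rpower (piston_speed q) e
                        * Rpower (ambient q) ((gamma - 1) / (2 * gamma)))).
  { intros q. ring. }
  apply filterlim_0_scal, filterlim_piston_scal, filterlim_ambient_Rpower.
  exact exponent_pos.
Qed.

Lemma filterlim_velocity_error : filterlim velocity_error small (locally 0).
Proof.
  assert (0 < (gamma - 1) / gamma) by (apply Rdiv_lt_0_compat; lra).
  apply filterlim_ext with
    (f := fun q => Rpower (piston_speed q) ((gamma - 2) / gamma)
                   * Rpower (ambient q) ((gamma - 1) / gamma)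
                   + delta * Rpower (ambient q) ((gamma - 1) / gamma)).
  { intros q. unfold velocity_error. ring. }
  rewrite <- (Rplus_0_r 0). apply filterlim_Rplus.
  - now apply filterlim_piston_scal, filterlim_ambient_Rpower.
  - now apply filterlim_0_scal, filterlim_ambient_Rpower.
Qed.

(** The ambient power in [velocity_error] is the square of the one in [sound_scale], so one factor
    survives in the quotient and drives it to 0. *)
Lemma filterlim_velocity_error_sound_scale :
  filterlim (fun q => velocity_error q / sound_scale q) small (locally 0).
Proof.
  pose proof sqrt_gamma_pos as Hs.
  apply filterlim_ext with
    (f := fun q => / sqrt gamma
             * (Rpower (piston_speed q) (- (1 / gamma))
                * Rpower (ambient q) ((gamma - 1) / (2 * gamma))
                + delta * (Rpower (piston_speed q) (- ((gamma - 1) / gamma))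
                           * Rpower (ambient q) ((gamma - 1) / (2 * gamma))))).
  { intros q. unfold velocity_error, sound_scale.
    replace (- (1 / gamma)) with ((gamma - 2) / gamma - (gamma - 1) / gamma)
      by (field; lra).
    replace (Rpower (ambient q) ((gamma - 1) / gamma))
      with (Rpower (ambient q) ((gamma - 1) / (2 * gamma))
            * Rpower (ambient q) ((gamma - 1) / (2 * gamma))).
    2:{ rewrite <- Rpower_plus. f_equal. field. lra. }
    rewrite Rpower_sub, Rpower_Ropp.
    pose proof (Rpower_pos (piston_speed q) ((gamma - 1) / gamma)).
    pose proof (Rpower_pos (ambient q) ((gamma - 1) / (2 * gamma))).
    field. lra. }
  apply filterlim_0_scal. rewrite <- (Rplus_0_r 0). apply filterlim_Rplus.
  - apply filterlim_piston_scal, filterlim_ambient_Rpower, exponent_pos.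
  - apply filterlim_0_scal, filterlim_piston_scal, filterlim_ambient_Rpower,
      exponent_pos.
Qed.

(** * Asymptotics at the shock *)

Lemma filterlim_shock_speed :
  filterlim (fun q => shock_speed q / piston_speed q) small (locally 1).
Proof.
  rewrite <- (Rplus_0_r 1).
  refine (filterlim_ext_loc
    (* The division is written as a power -1 so that [filterlim_piston_scal] applies. *)
    (fun q => 1 + Rpower (piston_speed q) (- (1))
                  * (shock_speed q - piston_speed q)) _ _ _).
  { apply small_admissible. intros q Hq. pose proof (adm_piston_pos q Hq).
    rewrite Rpower_Ropp, Rpower_1 by easy. field. lra. }
  apply filterlim_Rplus; [apply filterlim_const|].
  apply filterlim_piston_scal.
  apply filterlim_0_le with (2 := filterlim_velocity_error).
  apply small_admissible. intros q Hq. exact (adm_velocity_piston q Hq).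
Qed.

(* Eliminating the velocity from the Rankine-Hugoniot conditions. *)
Lemma shock_relation (q : flow_state) :
  admissible q ->
  let y := ambient q / shock_density q in
  shock_speed q ^ 2 * ambient q * (1 - y)
  = Rpower (shock_density q) gamma * (1 - Rpower y gamma).
Proof.
  intros Hq y.
  pose proof (adm_ambient q Hq). pose proof (adm_entropy q Hq).
  pose proof (adm_mass q Hq) as Hm. pose proof (adm_momentum q Hq) as Hp.
  (* Hence s' - u = y s', and the momentum condition, read as rho u (s' - u) = rho^gamma -
     rho_inf^gamma, becomes the claim because rho y = rho_inf. *)
  assert (shock_velocity q = (1 - y) * shock_speed q) as Hv.
  { unfold y. apply Rmult_eq_reg_l with (shock_density q); [|lra].
    rewrite <- Hm. field. lra. }
  unfold y at 2. rewrite Rpower_Rdiv by lra.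
  pose proof (Rpower_pos (shock_density q) gamma).
  transitivity (Rpower (shock_density q) gamma - Rpower (ambient q) gamma).
  2:{ field. lra. }
  replace (Rpower (shock_density q) gamma - Rpower (ambient q) gamma)
    with (shock_density q * shock_velocity q * (shock_speed q - shock_velocity q))
    by lra.
  rewrite Hv. unfold y. field. lra.
Qed.

Lemma adm_compression (q : flow_state) :
  admissible q -> 0 < ambient q / shock_density q < 1.
Proof.
  intros Hq. pose proof (adm_ambient q Hq). pose proof (adm_entropy q Hq).
  split.
  - apply Rdiv_lt_0_compat; lra.
  - apply Rlt_div_l; lra.
Qed.

(** A lower bound for rho^gamma by a multiple of w'^2 rho_inf suffices, since y^gamma =
    rho_inf^gamma / rho^gamma is then at most a multiple of rho_inf^(gamma - 1) / w'^2. *)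
Lemma filterlim_compression_Rpower :
  filterlim (fun q => Rpower (ambient q / shock_density q) gamma) small
    (locally 0).
Proof.
  apply filterlim_0_le with
    (* 12 = 3 * 4: the 3 comes from 1 - y^gamma <= 3 (1 - y), the 4 from w' < 2 s', which holds
       eventually. *)
    (g := fun q => 12 * (Rpower (piston_speed q) (- (2))
                         * Rpower (ambient q) (gamma - 1))).
  2:{ apply filterlim_0_scal, filterlim_piston_scal, filterlim_ambient_Rpower.
      lra. }
  assert (/ 2 < 1) as Hhalf by lra.
  generalize (filter_and _ _ (small_admissible _ (fun q Hq => Hq))
                (filterlim_gt _ _ _ Hhalf filterlim_shock_speed)).
  apply filter_imp. intros q [Hq HS].
  pose proof (adm_piston_pos q Hq) as HW.
  pose proof (adm_ambient q Hq) as Hr. pose proof (adm_entropy q Hq) as Hp.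
  pose proof (adm_compression q Hq) as Hy.
  pose proof (shock_relation q Hq) as Hrel. cbv zeta in Hrel.
  assert (piston_speed q / 2 < shock_speed q) as HS'.
  { apply Rlt_div_r in HS; lra. }
  rewrite Rabs_pos_eq by apply Rlt_le, Rpower_pos.
  set (y := ambient q / shock_density q) in *.
  (* Since [gamma < 3], [1 - y ^ gamma <= 1 - y ^ 3 <= 3 (1 - y)]. *)
  assert (y ^ 3 <= Rpower y gamma) as Hy3.
  { rewrite <- Rpower_pow by lra. unfold Rpower. apply Rlt_le, exp_increasing.
    assert (ln y < 0) by (rewrite <- ln_1; apply ln_increasing; lra).
    simpl INR. nra. }
  assert (1 - Rpower y gamma <= 3 * (1 - y)) as Hb.
  (* This product is y^3 - 3 y + 2, so its sign says 1 - y^3 <= 3 (1 - y). *)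
  { assert (0 <= (1 - y) ^ 2 * (y + 2))
      by (apply Rmult_le_pos; [apply pow2_ge_0|lra]).
    lra. }
  pose proof (Rpower_pos (shock_density q) gamma) as Hpg.
  assert (shock_speed q ^ 2 * ambient q <= 3 * Rpower (shock_density q) gamma)
    as Hlow.
  { apply Rmult_le_reg_r with (1 - y); [lra|]. rewrite Hrel.
    apply Rmult_le_compat_l with (r := Rpower (shock_density q) gamma) in Hb;
      lra. }
  unfold y. rewrite Rpower_Rdiv by lra.
  rewrite Rpower_Ropp, Rpower_sub, Rpower_1 by easy.
  replace 2 with (INR 2) by (simpl; lra). rewrite Rpower_pow by easy.
  pose proof (Rpower_pos (ambient q) gamma) as Hrg.
  (* The multiplier clears all denominators and leaves w'^2 rho_inf <= 12 rho^gamma. *)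
  apply Rmult_le_reg_r
    with (Rpower (shock_density q) gamma * piston_speed q ^ 2 * ambient q
          / Rpower (ambient q) gamma).
  { apply Rdiv_lt_0_compat; [|easy].
    apply Rmult_lt_0_compat; [apply Rmult_lt_0_compat|]; auto using pow_lt. }
  replace (Rpower (ambient q) gamma / Rpower (shock_density q) gamma
           * (Rpower (shock_density q) gamma * piston_speed q ^ 2 * ambient q
              / Rpower (ambient q) gamma))
    with (piston_speed q ^ 2 * ambient q) by (field; lra).
  replace (12 * (/ piston_speed q ^ 2 * (Rpower (ambient q) gamma / ambient q))
           * (Rpower (shock_density q) gamma * piston_speed q ^ 2 * ambient q
              / Rpower (ambient q) gamma))
    with (4 * (3 * Rpower (shock_density q) gamma)) by (field; lra).
  assert (piston_speed q ^ 2 <= 4 * shock_speed q ^ 2) by nra.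
  nra.
Qed.

Lemma filterlim_compression :
  filterlim (fun q => ambient q / shock_density q) small (at_right 0).
Proof.
  assert (0 < / gamma) as Hg by (apply Rinv_0_lt_compat; lra).
  apply filterlim_at_right_intro.
  { apply small_admissible. intros q Hq. now apply adm_compression. }
  refine (filterlim_ext_loc
    (fun q => Rpower (Rpower (ambient q / shock_density q) gamma) (/ gamma))
    _ _ _).
  { apply small_admissible. intros q Hq.
    rewrite Rpower_mult, Rinv_r, Rpower_1 by (lra || now apply adm_compression).
    easy. }
  refine (filterlim_comp _ _ _ _ _ _ _ _ _ (filterlim_Rpower_0 _ Hg)).
  apply filterlim_at_right_intro; [|exact filterlim_compression_Rpower].
  apply small_admissible. intros q _. apply Rpower_pos.
Qed.

(** Since [density_scale] to the power gamma is w'^2 rho_inf, the shock relation makes the gamma-th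
    power of the ratio equal to (s' / w')^2 (1 - y) / (1 - y^gamma), whose factors now all have
    limit 1. *)
Lemma filterlim_shock_density :
  filterlim (fun q => shock_density q / density_scale q) small (locally 1).
Proof.
  refine (filterlim_ext_loc
    (fun q =>
       Rpower ((shock_speed q / piston_speed q) * (shock_speed q / piston_speed q)
               * ((1 - ambient q / shock_density q)
                  / (1 - Rpower (ambient q / shock_density q) gamma)))
         (/ gamma)) _ _ _).
  { apply small_admissible. intros q Hq.
    pose proof (adm_piston_pos q Hq) as HW.
    pose proof (adm_ambient q Hq) as Hr. pose proof (adm_entropy q Hq) as Hp.
    pose proof (adm_compression q Hq) as Hy.
    pose proof (shock_relation q Hq) as Hrel. cbv zeta in Hrel.
    pose proof (Rpower_lt_1 (ambient q / shock_density q) gamma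
                  ltac:(lra) Hy) as Hyg.
    set (y := ambient q / shock_density q) in *.
    pose proof (density_scale_pos q) as HG.
    transitivity (Rpower (Rpower (shock_density q / density_scale q) gamma)
                    (/ gamma)).
    2:{ rewrite Rpower_mult, Rinv_r, Rpower_1; try lra.
        apply Rdiv_lt_0_compat; lra. }
    f_equal.
    rewrite Rpower_Rdiv by lra. unfold density_scale.
    rewrite <- Rpower_mult_distr, !Rpower_mult by apply Rpower_pos.
    replace (2 / gamma * gamma) with (INR 2) by (simpl; field; lra).
    replace (1 / gamma * gamma) with 1 by (field; lra).
    rewrite Rpower_pow, Rpower_1 by easy.
    apply Rmult_eq_reg_r with (ambient q * (1 - Rpower y gamma)).
    2:{ apply Rgt_not_eq, Rmult_lt_0_compat; lra. }
    transitivity (shock_speed q ^ 2 * ambient q * (1 - y) / piston_speed q ^ 2).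
    - field. lra.
    - rewrite Hrel. field. lra. }
  assert (forall a : R, filterlim (fun _ => a) small (locally a)) as Lc
      by (intros a; apply filterlim_const).
  pose proof filterlim_shock_speed as LS.
  assert (filterlim (fun q => ambient q / shock_density q) small (locally 0))
    as Ly.
  { exact (filterlim_comp _ _ _ _ _ _ _ _ filterlim_compression
             (filterlim_id_at_right 0)). }
  apply (filterlim_locally_eq _ _ _ (Rpower_1_l (/ gamma))).
  apply (filterlim_continuous (fun z => Rpower z (/ gamma))).
  { apply continuous_Rpower_l. lra. }
  apply (filterlim_locally_eq _ (1 * 1 * ((1 - 0) / (1 - 0)))); [field|].
  apply filterlim_Rmult; [now apply filterlim_Rmult|].
  apply filterlim_Rdiv; [lra| |]; apply filterlim_Rminus; auto.
  exact filterlim_compression_Rpower.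
Qed.

(** * From the shock to all of Omega, and the reflection coefficient *)

(** The exponent allowed for the oscillation splits as (gamma + 1) / (2 gamma) = 1 / gamma + (gamma
    - 1) / (2 gamma): the first summand is that of [density_scale], the second makes the relative
    oscillation vanish. *)
Lemma filterlim_density :
  filterlim (fun q => density q / density_scale q) small (locally 1).
Proof.
  apply filterlim_ext with
    (f := fun q => shock_density q / density_scale q
                   + (density q - shock_density q) / density_scale q).
  { intros q. pose proof (density_scale_pos q). field. lra. }
  apply (filterlim_locally_eq _ (1 + 0)); [ring|].
  apply filterlim_Rplus; [exact filterlim_shock_density|].
  apply filterlim_0_le with
    (g := fun q => Rpower (piston_speed q) (- (2 / gamma))
                   * Rpower (ambient q) ((gamma - 1) / (2 * gamma))).
  2:{ apply filterlim_piston_scal, filterlim_ambient_Rpower, exponent_pos. }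
  apply small_admissible. intros q Hq.
  pose proof (density_scale_pos q) as HG.
  rewrite Rabs_div, (Rabs_pos_eq (density_scale q)) by lra.
  apply Rle_div_l; [easy|].
  apply Rle_trans with (1 := adm_oscillation q Hq). right.
  replace ((gamma + 1) / (2 * gamma))
    with ((gamma - 1) / (2 * gamma) + 1 / gamma) by (field; lra).
  unfold density_scale. rewrite Rpower_plus, Rpower_Ropp.
  pose proof (Rpower_pos (piston_speed q) (2 / gamma)). field. lra.
Qed.

Lemma filterlim_sound :
  filterlim (fun q => sound_speed q / sound_scale q) small (locally 1).
Proof.
  refine (filterlim_ext_loc
    (fun q => Rpower (density q / density_scale q) ((gamma - 1) / 2)) _ _ _).
  { apply small_admissible. intros q Hq. pose proof (adm_density q Hq).
    pose proof (density_scale_pos q). pose proof sqrt_gamma_pos.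
    rewrite Rpower_Rdiv by easy. unfold density_scale, sound_speed, sound_scale.
    rewrite <- Rpower_mult_distr, !Rpower_mult by apply Rpower_pos.
    replace (2 / gamma * ((gamma - 1) / 2)) with ((gamma - 1) / gamma)
      by (field; lra).
    replace (1 / gamma * ((gamma - 1) / 2)) with ((gamma - 1) / (2 * gamma))
      by (field; lra).
    pose proof (Rpower_pos (piston_speed q) ((gamma - 1) / gamma)).
    pose proof (Rpower_pos (ambient q) ((gamma - 1) / (2 * gamma))).
    field. lra. }
  apply (filterlim_locally_eq _ _ _ (Rpower_1_l ((gamma - 1) / 2))).
  apply (filterlim_continuous (fun z => Rpower z ((gamma - 1) / 2))).
  { apply continuous_Rpower_l. lra. }
  exact filterlim_density.
Qed.

(** Both characteristic gaps are the sound speed plus a velocity difference [f]; [C] counts the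
    velocity bounds needed to control [f]. *)
Lemma filterlim_velocity_gap (f : flow_state -> R) (C : R) :
  (forall q, admissible q -> Rabs (f q) <= C * velocity_error q) ->
  filterlim (fun q => (f q + sound_speed q) / sound_scale q) small (locally 1).
Proof.
  intros Hf.
  apply filterlim_ext with
    (f := fun q => f q / sound_scale q + sound_speed q / sound_scale q).
  { intros q. pose proof (sound_scale_pos q). field. lra. }
  apply (filterlim_locally_eq _ (0 + 1)); [ring|].
  apply filterlim_Rplus; [|exact filterlim_sound].
  apply filterlim_0_le with
    (g := fun q => C * (velocity_error q / sound_scale q)).
  2:{ apply filterlim_0_scal, filterlim_velocity_error_sound_scale. }
  apply small_admissible. intros q Hq. pose proof (sound_scale_pos q).
  rewrite Rabs_div, (Rabs_pos_eq (sound_scale q)) by lra.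
  unfold Rdiv. rewrite <- Rmult_assoc.
  apply Rmult_le_compat_r; [|now apply Hf].
  apply Rlt_le, Rinv_0_lt_compat; easy.
Qed.

Lemma filterlim_forward_gap :
  filterlim (fun q => (velocity q + sound_speed q - shock_speed q)
                      / sound_scale q) small (locally 1).
Proof.
  apply filterlim_ext with
    (f := fun q => (velocity q - shock_speed q + sound_speed q) / sound_scale q).
  { intros q. f_equal. ring. }
  apply filterlim_velocity_gap with (C := 1). intros q Hq.
  rewrite Rabs_minus_sym, Rmult_1_l. exact (adm_velocity q Hq).
Qed.

Lemma filterlim_backward_gap :
  filterlim (fun q => (piston_speed q - (velocity q - sound_speed q))
                      / sound_scale q) small (locally 1).
Proof.
  apply filterlim_ext with
    (f := fun q => (piston_speed q - velocity q + sound_speed q) / sound_scale q).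
  { intros q. f_equal. ring. }
  (* w' and u are compared through s', at the cost of one bound each. *)
  apply filterlim_velocity_gap with (C := 2). intros q Hq.
  pose proof (adm_velocity q Hq) as H1.
  pose proof (adm_velocity_piston q Hq) as H2.
  fold (velocity_error q) in H1, H2.
  rewrite Rabs_minus_sym in H2.
  pose proof (Rabs_triang (piston_speed q - shock_speed q)
                (shock_speed q - velocity q)) as H3.
  replace (piston_speed q - shock_speed q + (shock_speed q - velocity q))
    with (piston_speed q - velocity q) in H3 by ring.
  lra.
Qed.

(** [reflection_scale] is 6 / sqrt gamma times the square root of [ambient q / density_scale q]. It
    differs from 6 sqrt (y / gamma) only by a power of the shock density ratio, which tends to 1. *)
Lemma filterlim_shock_reflection :
  filterlim (fun q => (1 - shock_reflection q) / reflection_scale q) small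
    (locally 1).
Proof.
  pose proof sqrt_gamma_pos as Hs.
  refine (filterlim_ext_loc
    (fun q => (1 - reflection gamma (/ (ambient q / shock_density q)))
              / sqrt (ambient q / shock_density q)
              * (sqrt gamma / 6
                 * Rpower (shock_density q / density_scale q) (- / 2))) _ _ _).
  { apply small_admissible. intros q Hq.
    pose proof (adm_ambient q Hq). pose proof (adm_entropy q Hq).
    pose proof (density_scale_pos q).
    rewrite Rinv_div. fold (shock_reflection q).
    rewrite sqrt_div_alt, Rpower_Rdiv by lra.
    rewrite <- (Rpower_sqrt (ambient q)), <- (Rpower_sqrt (shock_density q))
      by lra.
    unfold density_scale, reflection_scale.
    rewrite <- Rpower_mult_distr, !Rpower_mult by apply Rpower_pos.
    replace (2 / gamma * - / 2) with (- (1 / gamma)) by (field; lra).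
    replace (1 / gamma * - / 2) with ((gamma - 1) / (2 * gamma) - / 2)
      by (field; lra).
    rewrite Rpower_sub, (Rpower_Ropp (shock_density q)).
    pose proof (Rpower_pos (piston_speed q) (- (1 / gamma))).
    pose proof (Rpower_pos (ambient q) ((gamma - 1) / (2 * gamma))).
    pose proof (Rpower_pos (ambient q) (/ 2)).
    pose proof (Rpower_pos (shock_density q) (/ 2)).
    field. lra. }
  apply (filterlim_locally_eq _
           (6 / sqrt gamma * (sqrt gamma / 6 * Rpower 1 (- / 2)))).
  { rewrite Rpower_1_l. field. lra. }
  apply filterlim_Rmult.
  - apply (filterlim_comp _ _ _ (fun q => ambient q / shock_density q)
             (fun y => (1 - reflection gamma (/ y)) / sqrt y) _ (at_right 0)).
    + exact filterlim_compression.
    + apply filterlim_reflection. lra.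
  - apply filterlim_Rmult; [apply filterlim_const|].
    apply (filterlim_continuous (fun z => Rpower z (- / 2))).
    + apply continuous_Rpower_l. lra.
    + exact filterlim_shock_density.
Qed.

(** * Transfer to families indexed by the ambient density *)

Section Family.
Context (D : R -> R * R -> Prop) (st : R -> R -> R -> flow_state).
Context (Hst : at_right 0 (fun r => forall x t, D r (x, t) ->
                 admissible (st r x t) /\ ambient (st r x t) = r)).

Lemma at_right_small (P : flow_state -> Prop) :
  small P -> at_right 0 (fun r => forall x t, D r (x, t) -> P (st r x t)).
Proof.
  intros [r0 [Hr0 HP]].
  assert (at_right 0 (fun r => r < r0)) as Hr.
  { exists (mkposreal r0 Hr0). intros r Hr _.
    change (Rabs (r - 0) < r0) in Hr. apply Rabs_def2 in Hr. lra. }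
  generalize (filter_and _ _ Hst Hr). apply filter_imp.
  intros r [H1 H2] x t HD. destruct (H1 x t HD) as [Hadm Heq].
  apply HP; [easy|]. now rewrite Heq.
Qed.

Lemma unif_lim_small (f : flow_state -> R) (l : R) :
  filterlim f small (locally l) -> unif_lim D (fun r x t => f (st r x t)) l.
Proof.
  intros Hf eps. rewrite filterlim_Rabs_locally in Hf.
  exact (at_right_small _ (Hf eps)).
Qed.

Lemma asymp_equiv_small (f g : flow_state -> R) :
  (forall q, 0 < g q) -> filterlim g small (locally 0) ->
  filterlim (fun q => f q / g q) small (locally 1) ->
  asymp_equiv D (fun r x t => f (st r x t)) (fun r x t => g (st r x t)).
Proof.
  intros Hpos Hg Hlim. repeat split.
  - apply (at_right_small (fun q => 0 < f q /\ 0 < g q)).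
    (* With tolerance 1 the lower bound is 0 * g, that is, positivity of [f]. *)
    generalize (filterlim_ratio_bounds f g 1 Rlt_0_1 Hpos Hlim). apply filter_imp.
    intros q [H _]. split; [lra|auto].
  - apply unif_lim_small. now apply filterlim_ratio_0 with g.
  - now apply unif_lim_small.
  - exact (unif_lim_small (fun q => f q / g q) 1 Hlim).
Qed.

End Family.

(** * Explicit bounds with margin sigma *)

Definition sound_estimates (sigma : R) (q : flow_state) : Prop :=
  let m := (sqrt gamma * Rpower wlo ((gamma - 1) / gamma) - sigma)
           * Rpower (ambient q) ((gamma - 1) / (2 * gamma)) in
  velocity q + sound_speed q - shock_speed q > m /\
  piston_speed q - (velocity q - sound_speed q) > m /\
  (sqrt gamma * Rpower whi ((gamma - 1) / gamma) + sigma)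
  * Rpower (ambient q) ((gamma - 1) / (2 * gamma)) > sound_speed q /\
  sound_speed q > m.

Lemma small_sound_estimates (sigma : R) :
  0 < sigma < sqrt gamma * Rpower wlo ((gamma - 1) / gamma) ->
  small (sound_estimates sigma).
Proof.
  intros Hsigma.
  set (e := (gamma - 1) / gamma) in *.
  pose proof sqrt_gamma_pos as Hs.
  assert (0 < e) as He by (apply Rdiv_lt_0_compat; lra).
  set (a := sqrt gamma * Rpower wlo e) in *.
  set (b := sqrt gamma * Rpower whi e).
  assert (0 < b) as Hb by (apply Rmult_lt_0_compat; [easy|apply Rpower_pos]).
  (* The limits give relative errors while sigma is absolute. This choice makes eps * a and eps * b
     at most sigma, so (1 - eps) v >= a - sigma and (1 + eps) v <= b + sigma for every v in [a, b];
     it also gives eps < 1. *)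
  assert (0 < Rmin (sigma / a) (sigma / b)) as Heps
      by (apply Rmin_pos; apply Rdiv_lt_0_compat; lra).
  pose proof (Rmin_l (sigma / a) (sigma / b)) as Hea.
  pose proof (Rmin_r (sigma / a) (sigma / b)) as Heb.
  set (eps := Rmin (sigma / a) (sigma / b)) in *.
  apply Rle_div_r in Hea; [|lra]. apply Rle_div_r in Heb; [|easy].
  pose proof (fun f => filterlim_ratio_bounds (F := small) f _ eps Heps
                         sound_scale_pos) as B.
  generalize (filter_and _ _ (small_admissible _ (fun q Hq => Hq))
    (filter_and _ _ (B _ filterlim_forward_gap)
    (filter_and _ _ (B _ filterlim_backward_gap) (B _ filterlim_sound)))).
  apply filter_imp. intros q (Hq & [H1 _] & [H2 _] & [H3 H4]).
  pose proof (adm_piston q Hq) as HW.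
  pose proof (Rpower_pos (ambient q) ((gamma - 1) / (2 * gamma))) as HR.
  assert (a <= sqrt gamma * Rpower (piston_speed q) e <= b) as [Hlo Hhi].
  { split; (apply Rmult_le_compat_l; [lra|]; apply Rle_Rpower_l; lra). }
  unfold sound_scale in *. fold e in H1, H2, H3, H4.
  set (v := sqrt gamma * Rpower (piston_speed q) e) in *.
  set (z := Rpower (ambient q) ((gamma - 1) / (2 * gamma))) in *.
  assert (eps < 1) by nra.
  assert ((a - sigma) * z <= (1 - eps) * (v * z)) as Hm.
  { rewrite <- Rmult_assoc. apply Rmult_le_compat_r; [lra|]. nra. }
  assert ((1 + eps) * (v * z) <= (b + sigma) * z) as HM.
  { rewrite <- Rmult_assoc. apply Rmult_le_compat_r; [lra|]. nra. }
  unfold sound_estimates. fold e a b z. cbv zeta. lra.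
Qed.

Lemma small_reflection_estimate (sigma : R) :
  0 < sigma < 6 / sqrt gamma * Rpower whi (- (1 / gamma)) ->
  small (fun q => Rabs (shock_reflection q)
                  <= 1 - (6 / sqrt gamma * Rpower whi (- (1 / gamma)) - sigma)
                         * Rpower (ambient q) ((gamma - 1) / (2 * gamma))).
Proof.
  intros Hsigma.
  set (a := 6 / sqrt gamma * Rpower whi (- (1 / gamma))) in *.
  assert (0 < sigma / a) as Heps by (apply Rdiv_lt_0_compat; lra).
  assert (sigma / a * a = sigma) as Ha by (field; lra).
  set (eps := sigma / a) in *.
  assert (filterlim reflection_scale small (locally 0)) as Hscale
      by exact (filterlim_scale _ _).
  pose proof (filterlim_ratio_0 _ _ reflection_scale_pos
                filterlim_shock_reflection Hscale) as H0.
  generalize (filter_and _ _ (small_admissible _ (fun q Hq => Hq))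
    (filter_and _ _ (filterlim_lt _ _ _ Rlt_0_1 H0)
       (filterlim_ratio_bounds _ _ eps Heps reflection_scale_pos
          filterlim_shock_reflection))).
  apply filter_imp. intros q (Hq & H1 & [H2 _]).
  pose proof (adm_piston q Hq) as HW. pose proof sqrt_gamma_pos as Hs.
  assert (0 < / gamma) as Hg by (apply Rinv_0_lt_compat; lra).
  pose proof (Rpower_pos (ambient q) ((gamma - 1) / (2 * gamma))) as HR.
  (* The exponent is negative, so the worst case is the largest piston speed; hence [whi] in this
     bound. *)
  assert (a <= 6 / sqrt gamma * Rpower (piston_speed q) (- (1 / gamma))) as Hlo.
  { apply Rmult_le_compat_l; [apply Rlt_le, Rdiv_lt_0_compat; lra|].
    rewrite !Rpower_Ropp. apply Rinv_le_contravar; [apply Rpower_pos|].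
    apply Rle_Rpower_l; lra. }
  unfold reflection_scale in H2.
  set (v := 6 / sqrt gamma * Rpower (piston_speed q) (- (1 / gamma))) in *.
  set (z := Rpower (ambient q) ((gamma - 1) / (2 * gamma))) in *.
  rewrite Rabs_pos_eq by lra.
  assert (eps < 1) by nra.
  assert ((a - sigma) * z <= (1 - eps) * (v * z)) as Hm.
  { rewrite <- Rmult_assoc. apply Rmult_le_compat_r; [lra|]. nra. }
  lra.
Qed.

End SmallAmbientDensity.

(** * Back to the piston problem *)

Definition state_at (r : R) (w s : R -> R) (rho u : R -> R -> R) (x t : R)
    : flow_state :=
  {| ambient := r;
     piston_speed := Derive w t;
     shock_speed := Derive s t;
     density := rho x t;
     velocity := u x t;
     shock_density := rho (s t) t;
     shock_velocity := u (s t) t |}.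

Lemma state_at_admissible (gamma wlo whi delta1 delta2 r T : R) (w s : R -> R)
    (rho u : R -> R -> R) (x t : R) :
  piston_solution gamma r T w s rho u -> speed_bounds wlo whi w ->
  hypH gamma delta1 delta2 r T w s rho u -> Omega T w s (x, t) ->
  admissible gamma wlo whi delta1 (state_at r w s rho u x t).
Proof.
  intros Hsol Hspeed HH HO. pose proof (proj1 HO) as Ht. simpl in Ht.
  pose proof (ps_ahead _ _ _ _ _ _ _ Hsol t Ht) as Hahead.
  constructor; simpl.
  - exact (ps_rinf _ _ _ _ _ _ _ Hsol).
  - exact (ps_entropy _ _ _ _ _ _ _ Hsol t Ht).
  - exact (ps_rho_pos _ _ _ _ _ _ _ Hsol x t HO).
  - now apply Hspeed.
  - exact (ps_RH_mass _ _ _ _ _ _ _ Hsol t Ht).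
  - exact (ps_RH_momentum _ _ _ _ _ _ _ Hsol t Ht).
  - exact (H_density _ _ _ _ _ _ _ _ _ HH x t HO).
  - exact (H_velocity _ _ _ _ _ _ _ _ _ HH x t HO).
  (* The first rewrite turns every w'(t) into u(w(t),t), the second restores the one inside the
     power; the goal is then the velocity bound of (H) at x = w(t). *)
  - rewrite <- (ps_piston _ _ _ _ _ _ _ Hsol t Ht).
    rewrite (ps_piston _ _ _ _ _ _ _ Hsol t Ht) at 2.
    apply (H_velocity _ _ _ _ _ _ _ _ _ HH).
    split; simpl; [easy|lra].
Qed.

(** Choice must yield a function on all of R, so the guard [I sigma] sits inside the chosen
    relation. The value picked outside [I], here 0, is arbitrary. *)
Lemma small_threshold (gamma wlo whi delta : R) (I : R -> Prop)
    (P : R -> flow_state -> Prop) :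
  (forall sigma, I sigma -> small gamma wlo whi delta (P sigma)) ->
  exists E : R -> R, forall sigma, I sigma ->
    0 < E sigma /\
    forall q, admissible gamma wlo whi delta q -> ambient q < E sigma ->
    P sigma q.
Proof.
  intros HP.
  apply (functional_choice (fun sigma e => I sigma ->
    0 < e /\
    forall q, admissible gamma wlo whi delta q -> ambient q < e -> P sigma q)).
  intros sigma. destruct (classic (I sigma)) as [Hs|Hs].
  - destruct (HP sigma Hs) as [e He]. now exists e.
  - exists 0. easy.
Qed.

Theorem lemma4p1 :
  forall gamma wlo whi delta1 delta2 T : R,
  1 < gamma < 3 ->
  0 < wlo -> 0 < whi -> 0 < delta1 -> 0 < delta2 -> 0 < T ->
  (forall (w s : R -> R -> R) (rho u : R -> R -> R -> R),
     at_right 0 (fun r =>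
       piston_solution gamma r T (w r) (s r) (rho r) (u r) /\
       speed_bounds wlo whi (w r) /\
       hypH gamma delta1 delta2 r T (w r) (s r) (rho r) (u r)) ->
     asymp_equiv (fun r => Omega T (w r) (s r))
       (fun r x t => rho r x t)
       (fun r x t => Rpower (Derive (w r) t) (2 / gamma)
                     * Rpower r (1 / gamma)) /\
     asymp_equiv (fun r => Omega T (w r) (s r))
       (fun r x t => sound gamma (rho r) x t)
       (fun r x t => sqrt gamma * Rpower (Derive (w r) t) ((gamma - 1) / gamma)
                     * Rpower r ((gamma - 1) / (2 * gamma))) /\
     asymp_equiv (fun r => Omega T (w r) (s r))
       (fun r x t => lambda_plus gamma (rho r) (u r) x t - Derive (s r) t)
       (fun r x t => sqrt gamma * Rpower (Derive (w r) t) ((gamma - 1) / gamma)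
                     * Rpower r ((gamma - 1) / (2 * gamma))) /\
     asymp_equiv (fun r => Omega T (w r) (s r))
       (fun r x t => Derive (w r) t - lambda_minus gamma (rho r) (u r) x t)
       (fun r x t => sqrt gamma * Rpower (Derive (w r) t) ((gamma - 1) / gamma)
                     * Rpower r ((gamma - 1) / (2 * gamma))) /\
     asymp_equiv (fun r => Omega T (w r) (s r))
       (fun r x t => 1 - k_g gamma r (s r) (rho r) t)
       (fun r x t => 6 / sqrt gamma * Rpower (Derive (w r) t) (- (1 / gamma))
                     * Rpower r ((gamma - 1) / (2 * gamma)))) /\
  (exists E W : R -> R,
     (forall sigma,
        0 < sigma < sqrt gamma * Rpower wlo ((gamma - 1) / gamma) ->
        0 < E sigma) /\
     (forall sigma,
        0 < sigma < 6 / sqrt gamma * Rpower whi (- (1 / gamma)) ->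
        0 < W sigma) /\
     (forall (r : R) (w s : R -> R) (rho u : R -> R -> R),
        piston_solution gamma r T w s rho u ->
        speed_bounds wlo whi w ->
        hypH gamma delta1 delta2 r T w s rho u ->
        forall x t, Omega T w s (x, t) ->
        (forall sigma,
           0 < sigma < sqrt gamma * Rpower wlo ((gamma - 1) / gamma) ->
           0 < r < E sigma ->
           lambda_plus gamma rho u x t - Derive s t
             > (sqrt gamma * Rpower wlo ((gamma - 1) / gamma) - sigma)
               * Rpower r ((gamma - 1) / (2 * gamma)) /\
           Derive w t - lambda_minus gamma rho u x t
             > (sqrt gamma * Rpower wlo ((gamma - 1) / gamma) - sigma)
               * Rpower r ((gamma - 1) / (2 * gamma)) /\
           (sqrt gamma * Rpower whi ((gamma - 1) / gamma) + sigma)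
             * Rpower r ((gamma - 1) / (2 * gamma))
             > sound gamma rho x t /\
           sound gamma rho x t
             > (sqrt gamma * Rpower wlo ((gamma - 1) / gamma) - sigma)
               * Rpower r ((gamma - 1) / (2 * gamma))) /\
        (forall sigma,
           0 < sigma < 6 / sqrt gamma * Rpower whi (- (1 / gamma)) ->
           0 < r < W sigma ->
           Rabs (k_g gamma r s rho t)
             <= 1 - (6 / sqrt gamma * Rpower whi (- (1 / gamma)) - sigma)
                    * Rpower r ((gamma - 1) / (2 * gamma))))).
Proof.
  intros gamma wlo whi delta1 delta2 T Hgamma Hwlo Hwhi Hd1 Hd2 HT. split.
  - intros w s rho u Hfam.
    set (st := fun r => state_at r (w r) (s r) (rho r) (u r)).
    assert (at_right 0 (fun r => forall x t, Omega T (w r) (s r) (x, t) ->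
              admissible gamma wlo whi delta1 (st r x t)
              /\ ambient (st r x t) = r)) as Hst.
    { revert Hfam. apply filter_imp. intros r (Hsol & Hspeed & HH) x t HO.
      split; [|easy]. now apply state_at_admissible with delta2 T. }
    pose proof (asymp_equiv_small gamma wlo whi delta1
                  (fun r => Omega T (w r) (s r)) st Hst) as A.
    pose proof (filterlim_scale gamma wlo whi delta1 Hgamma Hwlo) as Hscale.
    repeat match goal with |- _ /\ _ => split end.
    (* These terms fit by conversion: projecting [st r x t] yields the quantities of the goal. *)
    + exact (A density (density_scale gamma) (density_scale_pos gamma)
               (filterlim_density_scale _ _ _ _ Hgamma Hwlo)
               (filterlim_density _ _ _ _ Hgamma Hwlo)).
    + exact (A (sound_speed gamma) (sound_scale gamma)
               (sound_scale_pos gamma Hgamma) (Hscale _ _)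
               (filterlim_sound _ _ _ _ Hgamma Hwlo)).
    + exact (A _ (sound_scale gamma) (sound_scale_pos gamma Hgamma) (Hscale _ _)
               (filterlim_forward_gap _ _ _ _ Hgamma Hwlo)).
    + exact (A _ (sound_scale gamma) (sound_scale_pos gamma Hgamma) (Hscale _ _)
               (filterlim_backward_gap _ _ _ _ Hgamma Hwlo)).
    + exact (A (fun q => 1 - shock_reflection gamma q) (reflection_scale gamma)
               (reflection_scale_pos gamma Hgamma) (Hscale _ _)
               (filterlim_shock_reflection _ _ _ _ Hgamma Hwlo)).
  - destruct (small_threshold gamma wlo whi delta1 _ _
                (small_sound_estimates gamma wlo whi delta1 Hgamma Hwlo))
      as [E HE].
    destruct (small_threshold gamma wlo whi delta1 _ _
                (small_reflection_estimate gamma wlo whi delta1 Hgamma Hwlo))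
      as [W HW].
    exists E, W.
    split; [intros; now apply HE|]. split; [intros; now apply HW|].
    intros r w s rho u Hsol Hspeed HH x t HO.
    pose proof (state_at_admissible _ _ _ _ _ _ _ _ _ _ _ x t
                  Hsol Hspeed HH HO) as Hadm.
    split; intros sigma Hsigma Hr.
    + exact (proj2 (HE sigma Hsigma) _ Hadm (proj2 Hr)).
    + exact (proj2 (HW sigma Hsigma) _ Hadm (proj2 Hr)).
Qed.
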